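(* There is no valuative matroid invariant (with values in the additive group $\mathbb R[q]$) whose restriction to simple matroids is $M\mapsto H_{\beta,M}(q)$. In particular, on simple matroids $H_\beta$ is not determined by the Tutte polynomial, by the catenary data, or by the Derksen $\mathcal G$-invariant: for each of these three invariants there exist two simple matroids on which that invariant agrees but $H_\beta$ differs.
   Context: Let $M$ be a simple matroid of rank $r$ on a finite ground set $E$, and let $L=L(M)$ be its lattice of flats, a geometric lattice with rank function $\mathrm{rk}$, bottom $\hat 0$, top $\hat 1$, and atom set $A$ (identified with $E$). $L_k$ is the set of flats of rank $k$. $\mathbb R[L]$ is the real vector space with basis $(e_x)_{x\in L}$. For an atom $a$, the linear operator $L_a$ on $\mathbb R[L]$ is $L_ae_x=e_{x\vee a}$ if $a\not\le x$, and $L_ae_x=0$ if $a\le x$. For $x\in L_k$, $\beta_x$ is the number of ordered atom bases of $x$, i.e. of tuples $(a_1,\dots,a_k)\in A^k$ with $a_1\vee\dots\vee a_k=x$ (so $\beta_{\hat 0}=1$). Put $v_k=\sum_{x\in L_k}\beta_xe_x$; in particular $v_r=\beta_{\hat 1}e_{\hat 1}$. Equip $\mathbb R[L]$ with the inner product $\langle e_x,e_y\rangle_\beta=\delta_{x,y}/\beta_x$ and let $L_a^\beta$ be the adjoint of $L_a$ for it. Put $U^\beta=\sum_{a\in A}L_a^\beta$, $Ke_x=\mathrm{rk}(x)e_x$, $s(x)=|A|-|\{a\in A:a\le x\}|$, and $S^{-1}e_x=s(x)^{-1}e_x$ for $x<\hat 1$, $S^{-1}e_{\hat 1}=0$. Define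 $D_\beta=S^{-1}U^\beta K$. Define $\mathcal C_0^\beta(M)=\mathbb R v_r$ and $\mathcal C_{k+1}^\beta(M)=D_\beta\mathcal C_k^\beta(M)+\sum_{a\in A}L_a^\beta\mathcal C_k^\beta(M)$; put $h_k^\beta(M)=\dim\mathcal C_k^\beta(M)$ and $H_{\beta,M}(q)=\sum_{k=0}^rh_k^\beta(M)q^k$. A matroid invariant $f$ is a function on all matroids, constant on isomorphism classes, with values in an abelian group. It is valuative if for every finite set $E$ and matroids $M_1,\dots,M_m$ on $E$ of the same rank and integers $c_1,\dots,c_m$, the relation $\sum_ic_i\mathbf 1_{P(M_i)}=0$ of indicator functions of base polytopes $P(M_i)=\mathrm{conv}\{\sum_{b\in B}\epsilon_b:B\text{ a basis of }M_i\}\subset\mathbb R^E$ (where $(\epsilon_e)_{e\in E}$ is the standard basis of $\mathbb R^E$) implies $\sum_ic_if(M_i)=0$. The Derksen $\mathcal G$-invariant of a matroid $M$ on an $n$-element set $E$ with rank function $r_M$ is the formal sum $\mathcal G(M)=\sum_\pi[\rho(\pi)]$ over all $n!$ orderings $\pi=(e_1,\dots,e_n)$ of $E$, in the free abelian group on $0/1$-sequences of length $n$, where $\rho(\pi)$ has $i$-th entry $r_M(\{e_1,\dots,e_i\})-r_M(\{e_1,\dots,e_{i-1}\})$. The catenary data of a rank-$r$ matroid $M$ on $E$ is the collection of numbers $\nu(M;a_0,\dots,a_r)$, where $\nu(M;a_0,\dots,a_r)$ counts the chains of flats $X_0\subset X_1\subset\dots\subset X_r=E$ with $\mathrm{rk}(X_i)=i$,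 $|X_0|=a_0$, and $|X_i\setminus X_{i-1}|=a_i$ for $1\le i\le r$. *)

(* Defs.v *)
From HB Require Import structures.
From mathcomp Require Import classical_sets reals numfun freeg.
From mathcomp Require Import all_boot all_order all_algebra.

Set Implicit Arguments.
Unset Strict Implicit.
Unset Printing Implicit Defensive.

Import Order.TTheory GRing.Theory Num.Theory.
Local Open Scope ring_scope.

(* Matroids on a finite ground set, given by their rank function. *)
Record matroid (E : finType) := Matroid {
  rk : {set E} -> nat;
  rk_le_card : forall A : {set E}, (rk A <= #|A|)%N;
  rk_mono : forall A B : {set E}, A \subset B -> (rk A <= rk B)%N;
  rk_submod : forall A B : {set E},
    (rk (A :|: B) + rk (A :&: B) <= rk A + rk B)%N
}.

Section Matroid.
Variables (E : finType) (M : matroid E).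
Implicit Types (A B F G : {set E}).

Definition mrank : nat := rk M [set: E].

Definition is_basis B : bool := (rk M B == #|B|) && (rk M B == mrank).

Definition simple_matroid : Prop :=
  (forall e : E, rk M [set e] = 1%N) /\
  (forall e f : E, e != f -> rk M [set e; f] = 2%N).

Definition is_flat F : bool :=
  [forall e, (e \notin F) ==> (rk M F < rk M (e |: F))%N].

Definition cl A : {set E} := [set e | rk M (e |: A) == rk M A].

Lemma sub_cl A : A \subset cl A.
Proof.
by apply/subsetP => e eA; rewrite inE (setUidPr _) // sub1set.
Qed.

Lemma rk_cl A : rk M (cl A) = rk M A.
Proof.
suff H (s : seq E) : {subset s <= cl A} -> rk M (A :|: [set x in s]) = rk M A.
  have := H (enum (cl A)) (fun x => etrans (esym (mem_enum _ x))).
  by rewrite set_enum (setUidPr (sub_cl A)).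
elim: s => [|e s IHs] sA.
  by congr (rk M _); apply/setP => x; rewrite !inE orbF.
have {}IHs : rk M (A :|: [set x in s]) = rk M A.
  by apply: IHs => x xs; apply: sA; rewrite inE xs orbT.
have := sA e; rewrite !inE eqxx => /(_ isT)/eqP eA.
apply/eqP; rewrite eqn_leq [X in _ && X]rk_mono ?subsetUl // andbT.
have := rk_submod M (e |: A) (A :|: [set x in s]).
have -> : (e |: A) :|: (A :|: [set x in s]) = A :|: [set x in e :: s].
  by apply/setP => x; rewrite !inE; do !case: (_ \in _); rewrite ?orbT ?orbF.
have /(rk_mono M) : A \subset (e |: A) :&: (A :|: [set x in s]).
  by rewrite subsetI subsetUl subsetUr.
by rewrite IHs eA => ? H; rewrite -(leq_add2r (rk M A));
  apply: leq_trans H; rewrite leq_add2l.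
Qed.

Lemma cl_flat A : is_flat (cl A).
Proof.
apply/forallP => e; apply/implyP; rewrite rk_cl inE => ne.
have H : (rk M A < rk M (e |: A))%N.
  by rewrite ltn_neqAle eq_sym ne rk_mono // subsetUr.
by apply: leq_trans H _; rewrite rk_mono // setUS // sub_cl.
Qed.

Lemma cl_min A F : is_flat F -> A \subset F -> cl A \subset F.
Proof.
move=> /forallP fF AF; apply/subsetP => e; rewrite inE => /eqP eA.
apply/negPn/negP => eF; have := fF e; rewrite eF ltnNge /= => /negP; apply.
have := rk_submod M (e |: A) F; rewrite eA -setUA (setUidPr AF) => H.
rewrite -(leq_add2r (rk M A)) [X in (_ <= X)%N]addnC; apply: leq_trans H.
by rewrite leq_add2l rk_mono // subsetI subsetUr AF.
Qed.

Lemma is_flatE F : is_flat F = (cl F \subset F).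
Proof.
apply/idP/idP => [fF|H]; first exact: cl_min.
have -> : F = cl F by apply/eqP; rewrite eqEsubset sub_cl H.
exact: cl_flat.
Qed.

Lemma is_flatT : is_flat [set: E].
Proof. by rewrite is_flatE subsetT. Qed.

Lemma is_flatI F G : is_flat F -> is_flat G -> is_flat (F :&: G).
Proof.
move=> fF fG; rewrite is_flatE subsetI.
by rewrite !cl_min ?subsetIl ?subsetIr.
Qed.

End Matroid.

(* The lattice of flats L(M), ordered by inclusion. *)
Record flat (E : finType) (M : matroid E) := Flat {
  flat_set :> {set E};
  flatP : is_flat M flat_set
}.
HB.instance Definition _ E M := [isSub for @flat_set E M].
HB.instance Definition _ E M := [Finite of @flat E M by <:].

Fact flat_display : Order.disp_t. Proof. exact: Order.Disp tt tt. Qed.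

Section FlatLattice.
Variables (E : finType) (M : matroid E).
Implicit Types x y z : flat M.

Definition flat_le x y : bool := (x : {set E}) \subset y.
Definition flat_meet x y : flat M := Flat (is_flatI (flatP x) (flatP y)).
Definition flat_join x y : flat M := Flat (cl_flat M (x :|: y)).
Definition flat_bot : flat M := Flat (cl_flat M set0).
Definition flat_top : flat M := Flat (is_flatT M).

Lemma flat_le_refl : reflexive flat_le.
Proof. by move=> x; exact: subxx. Qed.
Lemma flat_le_anti : antisymmetric flat_le.
Proof. by move=> x y; rewrite -eqEsubset => /eqP/val_inj. Qed.
Lemma flat_le_trans : transitive flat_le.
Proof. by move=> y x z; exact: subset_trans. Qed.
HB.instance Definition _ := Order.Le_isPOrder.Build flat_display (flat M)
  flat_le_refl flat_le_anti flat_le_trans.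

Lemma flat_lexI x y z : flat_le x (flat_meet y z) = flat_le x y && flat_le x z.
Proof. exact: subsetI. Qed.
HB.instance Definition _ :=
  Order.POrder_isMeetSemilattice.Build flat_display (flat M) flat_lexI.

Lemma flat_leUx x y z : flat_le (flat_join x y) z = flat_le x z && flat_le y z.
Proof.
rewrite -subUset; apply/idP/idP; first exact/subset_trans/sub_cl.
exact/cl_min/flatP.
Qed.
HB.instance Definition _ :=
  Order.POrder_isJoinSemilattice.Build flat_display (flat M) flat_leUx.

Lemma flat_le0x x : flat_le flat_bot x.
Proof. by apply: cl_min; rewrite ?flatP ?sub0set. Qed.
HB.instance Definition _ :=
  Order.hasBottom.Build flat_display (flat M) flat_le0x.

Lemma flat_lex1 x : flat_le x flat_top.
Proof. exact: subsetT. Qed.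
HB.instance Definition _ :=
  Order.hasTop.Build flat_display (flat M) flat_lex1.

Lemma leflE x y : (x <= y)%O = ((x : {set E}) \subset y).
Proof. by []. Qed.

(* The atoms of L(M); for a simple M these are the singletons {e}, e : E. *)
Definition atom x : bool := rk M x == 1%N.

(* beta_x: the number of ordered atom bases of x. *)
Definition beta x : nat :=
  #|[set t : (rk M x).-tuple (flat M) |
      all atom t && ((\join_(a <- t) a)%O == x)]|.

Lemma beta_gt0 x : (0 < beta x)%N.
Proof.
suff H k : (k <= rk M x)%N -> exists t : seq (flat M),
    [/\ size t = k, all atom t, (\join_(a <- t) a <= x)%O
      & rk M (\join_(a <- t) a)%O = k].
  have [t [st at_ tx tk]] := H _ (leqnn _).
  apply/card_gt0P; exists (tcast st (in_tuple t)).
  rewrite inE val_tcast at_ /=; apply/eqP/le_anti; rewrite tx /= leflE.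
  apply/subsetP => e ex; apply/negPn/negP => et.
  have /forallP/(_ e) := flatP (\join_(a <- t) a)%O.
  rewrite et tk ltnNge /= => /negP; apply.
  by rewrite rk_mono // subUset sub1set ex.
elim: k => [_|k IHk kx].
  exists [::]; split=> //; first by rewrite big_nil le0x.
  rewrite big_nil rk_cl; apply/eqP; rewrite -leqn0.
  by apply: leq_trans (rk_le_card _ _) _; rewrite cards0.
have [t [st at_]] := IHk (ltnW kx); set z := (\join_(a <- t) a)%O => tx tk.
have /subsetPn[e ex ez] : ~~ ((x : {set E}) \subset z).
  by apply/negP => /(rk_mono M); rewrite tk leqNgt kx.
pose a := Flat (cl_flat M [set e]).
have ea : e \in (a : {set E}) by apply: (subsetP (sub_cl M [set e])); rewrite inE.
have a1 : rk M a = 1%N.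
  rewrite rk_cl; apply/eqP; rewrite eqn_leq -{1}(cards1 e) rk_le_card /=.
  rewrite lt0n; apply: contra ez => e0.
  apply: (subsetP (flat_le0x z)); rewrite inE setU0 (eqP e0) eq_sym -leqn0.
  by apply: leq_trans (rk_le_card _ _) _; rewrite cards0.
exists (a :: t); rewrite big_cons -/z /= st /atom a1; split=> //.
  rewrite leUx tx andbT; apply: cl_min; first exact: flatP.
  by rewrite sub1set.
apply/eqP; rewrite eqn_leq; apply/andP; split.
  rewrite rk_cl -tk -add1n -a1.
  by apply: leq_trans (rk_submod _ _ _); rewrite leq_addr.
have /forallP/(_ e) := flatP z; rewrite ez tk /= => H.
apply: leq_trans H _; rewrite rk_cl rk_mono // subUset subsetUr andbT.
by rewrite sub1set inE ea.
Qed.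

End FlatLattice.

Section Hbeta.
Variables (R : realType) (E : finType) (M : matroid E).

(* R[L], with basis (e_ x)_x. *)
Local Notation RL := {ffun flat M -> R^o}.
Implicit Types (x y a : flat M) (u v : RL) (g : flat M -> RL) (T : 'End(RL)).

Lemma RL_addE u v x : (u + v) x = u x + v x.
Proof. exact: ffunE. Qed.

Lemma RL_scaleE (c : R) u x : (c *: u) x = c * u x.
Proof. exact: ffunE. Qed.

Definition e_ x : RL := [ffun y => (y == x)%:R].

Definition lin_ext_fun g u : RL := \sum_x u x *: g x.

Lemma lin_ext_fun_linear g : linear (lin_ext_fun g).
Proof.
move=> c u v; rewrite /lin_ext_fun scaler_sumr -big_split /=.
by apply: eq_bigr => x _; rewrite RL_addE RL_scaleE scalerDl scalerA.
Qed.
HB.instance Definition _ g :=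
  GRing.isLinear.Build R RL RL _ (lin_ext_fun g) (lin_ext_fun_linear g).

(* The linear operator with e_x |-> g x. *)
Definition lin_ext g : 'End(RL) := linfun (lin_ext_fun g).

Lemma lin_extE g u : lin_ext g u = \sum_x u x *: g x.
Proof. by rewrite lfunE. Qed.

Lemma lin_ext_e g x : lin_ext g (e_ x) = g x.
Proof.
rewrite lin_extE (bigD1 x) //= ffunE eqxx scale1r big1 ?addr0 // => y yx.
by rewrite ffunE (negPf yx) scale0r.
Qed.

Lemma RL_sum_e u : u = \sum_x u x *: e_ x.
Proof.
apply/ffunP => y; rewrite sum_ffunE (bigD1 y) //= big1 ?addr0 => [|x xy].
  by rewrite RL_scaleE ffunE eqxx mulr1.
by rewrite RL_scaleE ffunE eq_sym (negPf xy) mulr0.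
Qed.

(* The inner product with <e_x, e_y> = delta_{x,y} / beta_x. *)
Definition dot_beta u v : R := \sum_x u x * v x / (beta x)%:R.

(* The adjoint for dot_beta, by its matrix in the orthogonal basis (e_ x);
   see adj_betaP and adj_beta_uniq. *)
Definition adj_beta T : 'End(RL) :=
  lin_ext (fun y => \sum_x ((beta x)%:R * dot_beta (T (e_ x)) (e_ y)) *: e_ x).

Lemma dot_beta_e u y : dot_beta u (e_ y) = u y / (beta y)%:R.
Proof.
rewrite /dot_beta (bigD1 y) //= ffunE eqxx mulr1 big1 ?addr0 // => x xy.
by rewrite ffunE (negPf xy) mulr0 mul0r.
Qed.

Lemma dot_betaC u v : dot_beta u v = dot_beta v u.
Proof. by apply: eq_bigr => x _; rewrite (mulrC (u x)). Qed.

Lemma dot_beta_suml (I : finType) (c : I -> R) (F : I -> RL) v :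
  dot_beta (\sum_i c i *: F i) v = \sum_i c i * dot_beta (F i) v.
Proof.
transitivity (\sum_x \sum_i c i * (F i x * v x / (beta x)%:R)).
  apply: eq_bigr => x _; rewrite sum_ffunE !mulr_suml; apply: eq_bigr => i _.
  by rewrite RL_scaleE !mulrA.
by rewrite exchange_big; apply: eq_bigr => i _; rewrite mulr_sumr.
Qed.

Lemma beta_unit x : (beta x)%:R != 0 :> R.
Proof. by rewrite pnatr_eq0 -lt0n beta_gt0. Qed.

Lemma adj_beta_e T x y :
  dot_beta (T (e_ x)) (e_ y) = dot_beta (e_ x) (adj_beta T (e_ y)).
Proof.
rewrite lin_ext_e (dot_betaC (e_ x)) dot_beta_suml (bigD1 x) //= big1.
  by rewrite addr0 !dot_beta_e ffunE eqxx mul1r mulrAC divff ?mul1r ?beta_unit.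
by move=> z zx; rewrite !dot_beta_e ffunE eq_sym (negPf zx) mul0r mulr0.
Qed.

Lemma adj_betaP T u v : dot_beta (T u) v = dot_beta u (adj_beta T v).
Proof.
rewrite {1}(RL_sum_e u) linear_sum /=.
under eq_bigr do rewrite linearZ /=.
rewrite dot_beta_suml [in RHS](RL_sum_e u) dot_beta_suml.
apply: eq_bigr => x _; congr (_ * _).
rewrite {1}(RL_sum_e v) dot_betaC dot_beta_suml.
rewrite {2}(RL_sum_e v) linear_sum /=.
under [in RHS]eq_bigr do rewrite linearZ /=.
rewrite [RHS]dot_betaC dot_beta_suml; apply: eq_bigr => y _; congr (_ * _).
by rewrite dot_betaC adj_beta_e dot_betaC.
Qed.

Lemma adj_beta_uniq T T' :
  (forall u v, dot_beta (T u) v = dot_beta u (T' v)) -> T' = adj_beta T.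
Proof.
move=> H; apply/lfunP => v; apply/ffunP => x.
have := H (e_ x) v; rewrite adj_betaP dot_betaC [in RHS]dot_betaC !dot_beta_e.
by move/(mulIf (invr_neq0 (beta_unit x))).
Qed.

Definition L_op a : 'End(RL) :=
  lin_ext (fun x => if (a <= x)%O then 0 else e_ (x `|` a)%O).

Definition Lbeta a : 'End(RL) := adj_beta (L_op a).

Definition Ubeta : 'End(RL) := \sum_(a | atom a) Lbeta a.

Definition K_op : 'End(RL) := lin_ext (fun x => (rk M x)%:R *: e_ x).

Definition s_ x : nat :=
  (#|[set a : flat M | atom a]| - #|[set a | atom a & (a <= x)%O]|)%N.

Definition Sinv : 'End(RL) :=
  lin_ext (fun x => if x == \top%O then 0 else (s_ x)%:R^-1 *: e_ x).

Definition Dbeta : 'End(RL) := (Sinv \o Ubeta \o K_op)%VF.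

Definition v_ (k : nat) : RL := \sum_(x : flat M | rk M x == k) (beta x)%:R *: e_ x.

Fixpoint Cbeta (k : nat) : {vspace RL} :=
  if k is k'.+1 then
    (Dbeta @: Cbeta k' + \sum_(a | atom a) Lbeta a @: Cbeta k')%VS
  else <[v_ (mrank M)]>%VS.

Definition hbeta (k : nat) : nat := \dim (Cbeta k).

Definition Hbeta : {poly R} := \poly_(k < (mrank M).+1) (hbeta k)%:R.

End Hbeta.

Definition matroid_iso (E1 E2 : finType) (M1 : matroid E1) (M2 : matroid E2) :=
  exists phi : E1 -> E2,
    bijective phi /\ forall A : {set E1}, rk M2 (phi @: A) = rk M1 A.

Definition matroid_invariant (G : zmodType)
    (f : forall E : finType, matroid E -> G) : Prop :=
  forall (E1 E2 : finType) (M1 : matroid E1) (M2 : matroid E2),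
    matroid_iso M1 M2 -> f E1 M1 = f E2 M2.

(* P(M): the convex hull of the indicator vectors of the bases in R^E. *)
Definition base_polytope (R : realType) (E : finType) (M : matroid E) :
    set {ffun E -> R^o} :=
  [set p | exists w : {set E} -> R,
    [/\ forall B, is_basis M B -> 0 <= w B,
        \sum_(B | is_basis M B) w B = 1
      & p = \sum_(B | is_basis M B) w B *: [ffun b => (b \in B)%:R]]]%classic.

Arguments base_polytope R {E} M.

Definition valuative (R : realType) (G : zmodType)
    (f : forall E : finType, matroid E -> G) : Prop :=
  forall (E : finType) (m : nat) (M : 'I_m -> matroid E) (c : 'I_m -> int),
    (forall i j, mrank (M i) = mrank (M j)) ->
    (forall p, \sum_(i < m) c i * \1_(base_polytope R (M i)) p = 0) ->
    \sum_(i < m) f E (M i) *~ c i = 0.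

(* T(M; x, y) by its corank-nullity expansion, with x = 'X%:P and y = 'X. *)
Definition tutte (E : finType) (M : matroid E) : {poly {poly int}} :=
  \sum_(A : {set E})
    ('X%:P - 1) ^+ (mrank M - rk M A) * ('X - 1) ^+ (#|A| - rk M A).

(* All entries of rho are 0 or 1, by monotonicity and
   submodularity. *)
Definition rho (E : finType) (M : matroid E) (p : seq E) : seq nat :=
  [seq (rk M [set x in take i.+1 p] - rk M [set x in take i p])%N
    | i <- iota 0 (size p)].

(* The orderings of E are the duplicate-free #|E|-tuples. *)
Definition derksenG (E : finType) (M : matroid E) : {freeg (seq nat)} :=
  \sum_(p : #|E|.-tuple E | uniq p) << rho M p >>.

(* nu(M; a_0, ..., a_r); it vanishes on sequences a of length other than
   r + 1 (the last condition fixes size a) and is not identically zero, so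
   nu M1 =1 nu M2 also says that M1 and M2 have the same rank. *)
Definition nu (E : finType) (M : matroid E) (a : seq nat) : nat :=
  #|[set X : (mrank M).+1.-tuple (flat M) |
      [&& sorted <%O X,
          [forall i, rk M (tnth X i) == i],
          tnth X ord_max == [set: E] :> {set E}
        & a == #|thead X| :: pairmap (fun F G : flat M => #|G :\: F|)
                                     (thead X) (behead X)]]|.

(* Main.v *)
Require Import Defs.
From mathcomp Require Import classical_sets boolp reals numfun freeg.
From mathcomp Require Import all_boot all_order all_algebra perm zify ring lra.

(** Fix r and a family [S] of [r]-subsets of [E], any two of which meet in at
    most [r - 2] points. The [r]-subsets outside [S] are the bases of a
    matroid (a sparse paving matroid) whose rank at [A] is min(|A|, r), less 1
    if [A] is in [S]: making a basis dependent changes a single value. Hence invariants assembled additively from rank values depend on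
    [S] through its cardinality only. This is proved for the Tutte polynomial
    ([tutte_sparse]), for the G-invariant ([derksenG_sparse]) and, when r =
    3, for the catenary data ([nu_sparse]).

    For an arbitrary valuative invariant the mechanism is geometric. The base
    polytope of the matroid of [S] is the hypersimplex cut by one inequality
    p(l) <= r - 1 for each l in [S] ([base_polytope_sparse]), and no point of
    the hypersimplex violates two of them ([uniform_two_members]). So adding
    l to [S] removes from the polytope a piece that depends on l alone, the
    one removed in passing from the uniform matroid to the family {l}. As the
    matroids of the families {l} and {l'} are isomorphic, a valuative
    invariant takes the same value on the families S + l and S + l'
    ([valuative_swap]).

    On the other side, the first level of the filtration is explicit: it is
    spanned by [v_ (r - 1)] and by the vectors w_a = sum of beta_H e_H over
    the hyperplanes H that avoid the atom a ([Cbeta1]). For a simple matroid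
    on n points these are n + 1 vectors. The dimension is n + 1 when they are
    independent ([hbeta1_eq_card]) and at most n when v_(r-1) is a
    combination of the w_a, that is, when the points carry weights whose sum
    over the complement of every hyperplane is 1 ([hbeta1_le_card]).

    In rank 3, [S] is a set of three-point lines. If all lines of [S] pass
    through z and cover the ground set, equal weights on the points other
    than z do the job, because every hyperplane contains exactly two such
    points ([hbeta1_pencil]). If some point lies on no line of [S], its
    two-point lines force all other weights to be equal, which a three-point
    line together with one more two-point line contradicts
    ([hbeta1_free_point]). On seven points, the pencil 012, 034, 056 and the
    triangle 012, 034, 135 (which misses 6) have three lines each and differ
    by one line; the first level has dimension at most 7 for the pencil and 8
    for the triangle. *)

Set Implicit Arguments.
Unset Strict Implicit.
Unset Printing Implicit Defensive.

Import Order.TTheory GRing.Theory Num.Theory.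

(** * Sparse paving matroids *)

Definition sparse_family (E : finType) (r : nat) (S : {set {set E}}) : Prop :=
  {in S, forall l : {set E}, #|l| = r} /\
  {in S &, forall l l' : {set E}, l != l' -> #|l :&: l'| + 2 <= r}.

Section SparsePaving.
Variables (E : finType) (r : nat) (S : {set {set E}}).
Hypothesis HS : sparse_family r S.
Implicit Types (A B : {set E}).

Let card_S A : A \in S -> #|A| = r.
Proof. by case: HS => H _; apply: H. Qed.

Definition sparse_rk A : nat := minn #|A| r - (A \in S).

Lemma sparse_rk_le_card A : sparse_rk A <= #|A|.
Proof. by rewrite /sparse_rk; lia. Qed.

Lemma sparse_rk_mono A B : A \subset B -> sparse_rk A <= sparse_rk B.
Proof.
move=> AB; have := subset_leq_card AB; rewrite /sparse_rk.
have [BS|_] := boolP (B \in S); last by lia.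
have [-> |] := eqVneq A B; first by rewrite BS.
move=> neq _; have : A \proper B by rewrite properEneq neq.
by move/proper_card; rewrite (card_S BS); lia.
Qed.

(** Nested sets are trivial. For incomparable [A] and [B] the truncated
    cardinality is submodular, and a unit lost on the right because [A] is in
    [S] is compensated by [A :&: B] being smaller than both sets; when both
    are in [S], the bound on [A :&: B] provides the two units. *)
Lemma sparse_rk_submod A B :
  sparse_rk (A :|: B) + sparse_rk (A :&: B) <= sparse_rk A + sparse_rk B.
Proof.
have [AB|nAB] := boolP (A \subset B).
  by rewrite (setUidPr AB) (setIidPl AB) addnC.
have [BA|nBA] := boolP (B \subset A).
  by rewrite (setUidPl BA) (setIidPr BA).
have IA : #|A :&: B| < #|A|.
  by apply: proper_card; rewrite properE subsetIl subsetI subxx.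
have IB : #|A :&: B| < #|B|.
  by apply: proper_card; rewrite properE subsetIr subsetI subxx andbT.
have := cardsUI A B; rewrite /sparse_rk.
have AS := @card_S A; have BS := @card_S B.
have ABS : A \in S -> B \in S -> #|A :&: B| + 2 <= r.
  move=> As Bs; case: HS => _; apply=> //.
  by apply: contraNneq nAB => ->.
case: (A \in S) (B \in S) AS BS ABS => [] [] AS BS ABS.
- by have := AS isT; have := BS isT; have := ABS isT isT; lia.
- by have := AS isT; lia.
- by have := BS isT; lia.
- by lia.
Qed.

Definition sparse_paving : matroid E :=
  Matroid sparse_rk_le_card sparse_rk_mono sparse_rk_submod.

Hypothesis rE : r < #|E|.

Lemma sparse_mrank : mrank sparse_paving = r.
Proof.
rewrite /mrank /= /sparse_rk cardsT.
have [/card_S|_] := boolP (_ \in S); first by rewrite cardsT; lia.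
by lia.
Qed.

Lemma sparse_basisE B : 0 < r ->
  is_basis sparse_paving B = (#|B| == r) && (B \notin S).
Proof.
move=> r0; rewrite /is_basis sparse_mrank /= /sparse_rk.
have := @card_S B; case: (B \in S) => /= [/(_ isT)|_]; lia.
Qed.

Lemma sparse_simple : 2 < r -> simple_matroid sparse_paving.
Proof.
move=> r2; split=> [e|e f ef] /=; rewrite /sparse_rk ?cards1 ?cards2 ?ef.
  have := @card_S [set e]; case: (_ \in S) => /= [/(_ isT)|_]; rewrite ?cards1;
    lia.
have := @card_S [set e; f]; case: (_ \in S) => /= [/(_ isT)|_];
  rewrite ?cards2 ?ef; lia.
Qed.

End SparsePaving.

(** * The Tutte polynomial and the G-invariant *)

Section SameCount.
Variables (E : finType) (r : nat) (S1 S2 : {set {set E}}).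
Hypotheses (H1 : sparse_family r S1) (H2 : sparse_family r S2).
Hypotheses (rE : r < #|E|) (cS : #|S1| = #|S2|).

(** The only way in which [S] enters the sums over all subsets below: a summand
    that is altered by a constant on the members of [S]. *)
Lemma sum_sparse (V : zmodType) (S : {set {set E}}) (F : {set E} -> V)
    (g : {set E} -> V) (d : V) :
  (forall A, A \notin S -> F A = g A) ->
  (forall A, A \in S -> F A = g A + d)%R ->
  (\sum_A F A = \sum_A g A + d *+ #|S|)%R.
Proof.
move=> Fg Fd; rewrite -sumr_const [X in (_ + X)%R]big_mkcond -big_split /=.
apply: eq_bigr => A _; case: ifP => [/Fd //|/negbT/Fg ->].
by rewrite addr0.
Qed.

Lemma tutte_sparse : tutte (sparse_paving H1) = tutte (sparse_paving H2).
Proof.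
rewrite /tutte !sparse_mrank //.
pose t (k : nat) (n : nat) : {poly {poly int}} :=
  (('X%:P - 1) ^+ (r - k) * ('X - 1) ^+ (n - k))%R.
(* d is the change of a summand when an r-set passes from basis to member. *)
pose d := (t r.-1 r - t r r)%R.
have key S (HS : sparse_family r S) :
  (\sum_(A : {set E}) t (rk (sparse_paving HS) A) #|A| =
    \sum_(A : {set E}) t (minn #|A| r) #|A| + d *+ #|S|)%R.
  apply: sum_sparse => A AS /=; rewrite /sparse_rk ?AS ?(negPf AS) ?subn0 //.
  case: (HS) => /(_ _ AS) -> _; rewrite minnn subn1 /d addrC subrK //.
by rewrite (key _ H1) (key _ H2) cS.
Qed.

End SameCount.

Lemma perm_between (E : finType) (A B : {set E}) :
  #|A| = #|B| -> exists phi : {perm E}, phi @: A = B.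
Proof.
move=> AB.
(* Match the enumerations of A and B, prolonged by their complements. *)
pose enum2 (C : {set E}) := enum C ++ enum (~: C).
have mem2 C x : x \in enum2 C by rewrite mem_cat !mem_enum inE orbN.
have uniq2 C : uniq (enum2 C).
  rewrite cat_uniq !enum_uniq andbT /=.
  by apply/hasPn => x; rewrite !mem_enum inE.
have size2 C : size (enum2 C) = #|E|.
  by rewrite size_cat -!cardE cardsC.
have eqsz : size (enum2 A) = size (enum2 B) by rewrite !size2.
pose f x := nth x (enum2 B) (index x (enum2 A)).
have f_inj : injective f.
  move=> x y; rewrite /f (set_nth_default y) ?eqsz -?eqsz ?index_mem //.
  move/eqP; rewrite nth_uniq // -?eqsz ?index_mem // => /eqP xy.
  by rewrite -(nth_index x (mem2 A x)) xy nth_index.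
exists (perm f_inj); apply/eqP; rewrite eqEcard card_imset ?AB ?leqnn ?andbT;
  last exact: perm_inj.
apply/subsetP => _ /imsetP[x xA ->]; rewrite permE /f.
have ix : index x (enum A) < size (enum B).
  by rewrite -cardE -AB cardE index_mem mem_enum.
by rewrite index_cat mem_enum xA nth_cat ix -mem_enum mem_nth.
Qed.

Lemma sparse_iso (E : finType) (r : nat) (S1 S2 : {set {set E}})
  (H1 : sparse_family r S1) (H2 : sparse_family r S2) (phi : {perm E}) :
  (forall A : {set E}, (phi @: A \in S2) = (A \in S1)) ->
  matroid_iso (sparse_paving H1) (sparse_paving H2).
Proof.
move=> phiS; exists phi; split; first by exists (phi^-1)%g;
  [exact: permK|exact: permKV].
by move=> A /=; rewrite /sparse_rk phiS card_imset //; exact: perm_inj.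
Qed.

Section Ordering.
Variables (E : finType) (r : nat).
Hypotheses (r0 : 0 < r) (rE : r < #|E|).

(** The rank sequence of an ordering of [E], where [b] tells whether its first
    [r] elements form a member of [S]; no other initial segment can. *)
Definition rho_by (b : bool) : seq nat :=
  [seq (minn i.+1 r - (b && (i.+1 == r))) - (minn i r - (b && (i == r)))
    | i <- iota 0 #|E|].

Lemma rho_sparse (S : {set {set E}}) (HS : sparse_family r S)
    (p : #|E|.-tuple E) : uniq p ->
  rho (sparse_paving HS) p = rho_by ([set x in take r p] \in S).
Proof.
move=> up; rewrite /rho /rho_by size_tuple; apply/eq_in_map => i.
rewrite mem_iota add0n => iE.
have rkE j : j <= #|E| -> sparse_rk r S [set x in take j p] =
    minn j r - (([set x in take r p] \in S) && (j == r)).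
  move=> jE; rewrite /sparse_rk cardsE (card_uniqP (take_uniq _ up)) size_takel
    ?size_tuple //.
  have [->|jr] := eqVneq j r; first by rewrite andbT.
  rewrite andbF subn0; have [|_] := boolP (_ \in S); last by rewrite subn0.
  case: HS => H _ /H; rewrite cardsE (card_uniqP (take_uniq _ up)) size_takel
    ?size_tuple //.
  by move/eqP; rewrite (negPf jr).
by rewrite /= !rkE // ltnW.
Qed.

Definition starts_with (l : {set E}) : pred (#|E|.-tuple E) :=
  fun p => uniq p && ([set x in take r p] == l).

Lemma card_starts_with (l l' : {set E}) : #|l| = #|l'| ->
  #|starts_with l| = #|starts_with l'|.
Proof.
suff le (k k' : {set E}) : #|k| = #|k'| -> #|starts_with k| <= #|starts_with
  k'|.
  by move=> ll'; apply/eqP; rewrite eqn_leq !le.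
case/perm_between => phi <-.
pose F (p : #|E|.-tuple E) := [tuple of map phi p].
have F_inj : injective F.
  by move=> p q /(congr1 val) /= /(inj_map (@perm_inj _ phi)) /val_inj.
rewrite -(card_image F_inj); apply/subset_leq_card/subsetP => q.
case/imageP => p /andP[up /eqP <-] ->.
rewrite unfold_in /= map_inj_uniq ?up; last exact: perm_inj.
apply/eqP/setP => x; rewrite inE -map_take.
apply/mapP/imsetP => -[y ys ->]; exists y => //; first by rewrite inE.
by move: ys; rewrite inE.
Qed.

(** An ordering starts with at most one member of [S], and each member begins
    the same number of orderings, so the terms altered by [S] are counted by
    #|S|. *)
Lemma derksenG_sparse (S1 S2 : {set {set E}}) (H1 : sparse_family r S1)
    (H2 : sparse_family r S2) :
  #|S1| = #|S2| ->
  derksenG (sparse_paving H1) = derksenG (sparse_paving H2).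
Proof.
move=> cS; pose G b : {freeg (seq nat)} := (<< rho_by b >>)%R.
have [l0 cl0] : exists l0 : {set E}, #|l0| = r.
  exists [set x in take r (enum E)].
  rewrite cardsE (card_uniqP (take_uniq _ (enum_uniq _))) size_takel //.
  by rewrite -cardE ltnW.
have key (S : {set {set E}}) (HS : sparse_family r S) :
  (derksenG (sparse_paving HS) =
   \sum_(p : #|E|.-tuple E | uniq p) G false +
   (G true - G false) *+ (#|starts_with l0| * #|S|))%R.
  have -> : ((G true - G false) *+ (#|starts_with l0| * #|S|) =
      \sum_(l in S) \sum_(p in starts_with l) (G true - G false))%R.
    rewrite mulrnA -sumr_const; apply: eq_bigr => l lS; rewrite sumr_const.
    by congr (_ *+ _)%R; apply: card_starts_with; rewrite cl0; case: HS => ->.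
  rewrite (exchange_big_dep (fun p : #|E|.-tuple E => uniq p)) /=; last first.
    by move=> l p _ /andP[].
  rewrite -big_split /=; apply: eq_bigr => p up; rewrite rho_sparse //.
  have [pS|pS] := boolP (_ \in S).
    rewrite (bigD1 [set x in take r p]) /=; last by rewrite pS unfold_in up
      eqxx.
    rewrite big1 ?addr0; first by rewrite addrC subrK.
    by move=> l /andP[/andP[_ /andP[_ /eqP <-]]]; rewrite eqxx.
  rewrite big1 ?addr0 // => l /andP[lS /andP[_ /eqP pl]].
  by rewrite pl lS in pS.
by rewrite (key _ H1) (key _ H2) cS.
Qed.
End Ordering.

(** * Flats, atoms and catenary data *)

Section Flats.
Variables (E : finType) (M : matroid E).
Implicit Types (x y a : flat M).

Lemma rk_flat_lt x y : (x < y)%O -> (rk M x < rk M y)%N.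
Proof.
rewrite lt_neqAle leflE => /andP[xy sxy].
have /subsetPn[e ey ex] : ~~ ((y : {set E}) \subset x).
  by apply: contra xy => yx; apply/eqP/val_inj/eqP; rewrite eqEsubset sxy.
have /forallP/(_ e) := flatP x; rewrite ex /= => h; apply: leq_trans h _.
by rewrite rk_mono // subUset sub1set ey.
Qed.

Lemma flat_top_rk x : (rk M x == mrank M) = (x == \top%O).
Proof.
apply/eqP/eqP => [xr|-> //]; apply/eqP/negPn/negP => /negPf xT.
have /rk_flat_lt : (x < \top)%O by rewrite lt_neqAle xT lex1.
by rewrite xr ltnNge rk_mono // subsetT.
Qed.

Lemma flat_eq_rk x y : (x <= y)%O -> rk M x = rk M y -> x = y.
Proof.
rewrite le_eqVlt => /predU1P[//|/rk_flat_lt xy e].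
by rewrite e ltnn in xy.
Qed.

(** Joining with an atom raises the rank of a flat that does not contain it by
    exactly one. *)
Lemma join_atom_top x a : (0 < mrank M)%N -> atom a ->
  ~~ (a <= x)%O && (x `|` a == \top)%O =
  (rk M x == (mrank M).-1) && ~~ (a <= x)%O.
Proof.
move=> r0 /eqP a1; rewrite andbC; have [ax|nax] := boolP (a <= x)%O.
  by rewrite !andbF.
rewrite !andbT -flat_top_rk.
have ltj : (rk M x < rk M (x `|` a)%O)%N.
  apply: rk_flat_lt; rewrite lt_neqAle leUl andbT.
  by apply: contra nax => /eqP ->; rewrite leUr.
have : (rk M (x `|` a)%O <= rk M x + 1)%N.
  rewrite rk_cl -a1; apply: leq_trans (rk_submod M x a); exact: leq_addr.
rewrite addn1 => lej; have -> : rk M (x `|` a)%O = (rk M x).+1.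
  by apply/eqP; rewrite eqn_leq lej.
by case: (mrank M) r0.
Qed.

Lemma exists_atom_not_le x : x != \top%O -> exists a, atom a && ~~ (a <= x)%O.
Proof.
move=> xT; have /subsetPn[e _ ex] : ~~ ([set: E] \subset x).
  apply: contra xT => Tx; apply/eqP/val_inj/eqP.
  by rewrite eqEsubset Tx subsetT.
pose a := Flat (cl_flat M [set e]).
have ea : e \in (a : {set E}) by apply: (subsetP (sub_cl M _)); rewrite set11.
have nax : ~~ (a <= x)%O.
  by apply: contra ex => /subsetP/(_ e ea).
exists a; rewrite nax andbT /atom rk_cl eqn_leq -{1}(cards1 e) rk_le_card /=.
rewrite lt0n; apply: contra nax => e0; rewrite leflE.
apply: cl_min (flatP x) _; rewrite sub1set.
apply: (subsetP (flat_le0x x)); rewrite inE setU0 (eqP e0) eq_sym -leqn0.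
by apply: leq_trans (rk_le_card _ _) _; rewrite cards0.
Qed.

Lemma s_E x : s_ x = #|[set a | atom a & ~~ (a <= x)%O]|.
Proof.
rewrite /s_ -(cardsID [set a | (a <= x)%O] [set a | atom a]).
rewrite (_ : _ :&: _ = [set a | atom a & (a <= x)%O]); last by apply/setP => a;
  rewrite !inE.
by rewrite addKn; apply: eq_card => a; rewrite !inE andbC.
Qed.

End Flats.

Section SimplePoints.
Variables (E : finType) (M : matroid E).
Hypothesis sM : simple_matroid M.

Definition point (e : E) : flat M := Flat (cl_flat M [set e]).

Lemma pointE e : point e = [set e] :> {set E}.
Proof.
case: sM => s1 s2; apply/eqP; rewrite eqEsubset sub_cl andbT.
apply/subsetP => f; rewrite !inE s1; have [//|fe] := eqVneq f e.
by rewrite s2.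
Qed.

Lemma point_inj : injective point.
Proof.
move=> e f /(congr1 (@flat_set E M)); rewrite !pointE => /setP/(_ e).
by rewrite !inE eqxx => /esym/eqP.
Qed.

Lemma point_le e (x : flat M) : (point e <= x)%O = (e \in (x : {set E})).
Proof. by rewrite leflE pointE sub1set. Qed.

Lemma atom_point (x : flat M) : reflect (exists e, x = point e) (atom x).
Proof.
case: (sM) => s1 _; apply: (iffP eqP) => [x1|[e ->]]; last by rewrite rk_cl s1.
have /set0Pn[e ex] : (x : {set E}) != set0.
  apply/eqP => x0; have := rk_le_card M x.
  by rewrite x1 x0 cards0.
by exists e; apply/esym/flat_eq_rk; rewrite ?point_le // rk_cl s1 x1.
Qed.

Lemma card_atom : #|@atom E M| = #|E|.
Proof.
rewrite -(card_codom point_inj); apply: eq_card => x.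
by apply/atom_point/codomP.
Qed.

Lemma sum_atom (V : nmodType) (P : pred (flat M)) (F : flat M -> V) :
  (\sum_(a | atom a && P a) F a = \sum_(e | P (point e)) F (point e))%R.
Proof.
rewrite big_mkcondr (eq_bigl (mem (point @: [set: E]))); last first.
  move=> x; apply/atom_point/imsetP => -[e]; first by move=> ->; exists e.
  by exists e.
rewrite big_imset /=; last by move=> e f _ _ /point_inj.
by rewrite [RHS]big_mkcond; apply: eq_bigl => e; rewrite inE.
Qed.

(** In rank 3 a complete chain of flats of a simple matroid is a flag of a point
    [e] on a line [H], which the sum counts line by line. *)
Lemma nu_simple3 a : mrank M = 3 ->
  nu M a = \sum_(H : flat M | rk M H == 2)
     #|H| * (a == [:: 0; 1; #|H|.-1; #|E| - #|H|]).
Proof.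
move=> r3.
pose Q := [set q : E * flat M | (rk M q.2 == 2) && (q.1 \in (q.2 : {set E}))
   && (a == [:: 0; 1; #|q.2|.-1; #|E| - #|q.2|])].
transitivity #|Q|; last first.
  rewrite -sum1dep_card -(pair_big_dep (fun _ => true)
    (fun (e : E) (H : flat M) => (rk M H == 2) && (e \in (H : {set E}))
   && (a == [:: 0; 1; #|H|.-1; #|E| - #|H|])) (fun _ _ => 1)) /=.
  rewrite (exchange_big_dep (fun H : flat M => rk M H == 2)) /=;
    last by move=> e H _ /andP[/andP[]].
  apply: eq_bigr => H ->; case: (a == _); last by rewrite muln0 big1 // => e;
    rewrite andbF.
  by rewrite muln1 -sum1_card; apply: eq_bigl => e; rewrite andbT.
have r0 : rk M set0 = 0 by have := rk_le_card M set0; rewrite cards0; lia.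
have bot0 : cl M set0 = set0.
  apply/setP => e; rewrite !inE setU0 r0.
  by case: (sM) => -> _.
have sizes e (H : flat M) : e \in (H : {set E}) ->
    [:: #|cl M set0|; #|point e :\: cl M set0|; #|H :\: point e|;
      #|[set: E] :\: H|]
    = [:: 0; 1; #|H|.-1; #|E| - #|H|].
  move=> eH; rewrite bot0 setD0 cards0 pointE cards1 setTD [#|~: _|]cardsCs
    setCK.
  by rewrite (cardsD1 e H) eH.
pose f (q : E * flat M) : 4.-tuple (flat M) :=
  [tuple \bot%O; point q.1; q.2; \top%O].
have f_inj : injective f.
  move=> [e H] [e' H'] ff.
  have /point_inj /= -> := congr1 (fun X : 4.-tuple _ => nth \bot%O X 1) ff.
  by have /= -> := congr1 (fun X : 4.-tuple _ => nth \bot%O X 2) ff.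
have top3 : rk M [set: E] = 3 := r3.
rewrite -(card_imset _ f_inj) /nu; move: (mrank M) r3 => k k3; subst k.
apply: eq_card => X; rewrite inE; apply/idP/imsetP.
  case: X => [[|x0 [|x1 [|x2 [|x3 []]]]]] //= sz.
  case/and4P => /and4P[_ x12 _ _] /forallP xr xT aE.
  have := xr (inord 0); have := xr (inord 1); have := xr (inord 2).
  rewrite !(tnth_nth x0) /= !inordK //= => x2r /atom_point[e x1e] /eqP x0r.
  have x0E : x0 = \bot%O by apply/esym/flat_eq_rk;
    rewrite ?le0x //= bot0 r0 x0r.
  have x3E : x3 = \top%O by apply/val_inj/eqP; move: xT; rewrite (tnth_nth x0).
  have ex2 : e \in (x2 : {set E}) by rewrite -point_le -x1e ltW.
  exists (e, x2); last by apply/val_inj; rewrite /= x0E x1e x3E.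
  by rewrite inE /= x2r ex2 -(sizes e) // -x1e; move: aE; rewrite x0E x3E.
case=> [[e H]]; rewrite inE /= => /andP[/andP[Hr eH] aE] ->.
have r1 : rk M (point e) = 1 by apply/eqP/atom_point; exists e.
rewrite -(sizes e) // in aE; apply/and4P; split=> //=.
- rewrite !lt_neqAle !le0x lex1 point_le eH !andbT.
  have rk_neq (x y : flat M) : rk M x != rk M y -> x != y.
    by apply: contra => /eqP ->.
  by rewrite !rk_neq //= ?(eqP Hr) ?r1 ?bot0 ?r0 // top3.
- apply/forallP => -[[|[|[|[|i]]]]] //= lti; rewrite ?(tnth_nth \bot%O) //=.
  + by rewrite bot0 r0.
  + by rewrite -[1]r1.
  + by rewrite top3.
Qed.
End SimplePoints.

Section NuSparse.
Variables (E : finType).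

Lemma sparse_hyperplane r (S : {set {set E}}) (HS : sparse_family r S) (H :
  {set E}) :
  (0 < r < #|E|) ->
  is_flat (sparse_paving HS) H && (rk (sparse_paving HS) H == r.-1) =
  (H \in S) || (#|H| == r.-1) && [forall l in S, ~~ (H \subset l)].
Proof.
move=> /andP[r0 rE]; have [h1 h2] := HS.
have [HinS|HnS] := boolP (H \in S); rewrite /= /sparse_rk.
  rewrite HinS h1 // minnn subn1 eqxx andbT.
  apply/forallP => e; apply/implyP => eH /=; rewrite /sparse_rk HinS h1 //
    cardsU1 eH h1 //.
  have [/h1|_] := boolP (_ |: _ \in S); first by rewrite cardsU1 eH h1 //; lia.
  lia.
rewrite (negPf HnS) subn0.
have [cH|ncH] := eqVneq #|H| r.-1; last first.
  by rewrite [_ == r.-1](_ : _ = false) ?andbF //; apply/eqP; lia.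
rewrite (_ : minn _ r = r.-1) ?eqxx ?andbT; last lia.
apply/forallP/forall_inP => /= [fl l lS|nc e].
  apply/negP => Hl; have /set0Pn[e] : l :\: H != set0.
    by rewrite setD_eq0; apply/negP => /subset_leq_card; rewrite (h1 _ lS) cH;
      lia.
  rewrite inE => /andP[eH el]; have eHl : e |: H = l.
    apply/eqP; rewrite eqEcard subUset sub1set el Hl cardsU1 eH (h1 _ lS) /=;
      lia.
  have := fl e; rewrite eH /= /sparse_rk eHl lS (negPf HnS) (h1 _ lS); lia.
apply/implyP => eH; rewrite /sparse_rk (negPf HnS) cardsU1 eH cH.
have [/nc|_] := boolP (_ |: _ \in S); first by rewrite subsetUr.
lia.
Qed.

(** Each [(r - 1)]-set lies in at most one member of [S], and each member
    contains [r] of them. *)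
Lemma card_uncovered r (S : {set {set E}}) : sparse_family r S -> 0 < r ->
  #|[set H : {set E} | (#|H| == r.-1) && [forall l in S, ~~ (H \subset l)]]|
    + r * #|S| = 'C(#|E|, r.-1).
Proof.
move=> [h1 h2] r0; have <- : #|[set H : {set E} | #|H| == r.-1]| = 'C(#|E|,
  r.-1).
  rewrite -cardsT -cards_draws; apply: eq_card => H.
  by rewrite !inE subsetT.
have -> : r * #|S| = \sum_(l in S) \sum_(H : {set E} | (H \subset l) && (#|H|
  == r.-1)) 1.
  rewrite mulnC -sum_nat_const; apply: eq_bigr => l lS.
  by rewrite sum1dep_card cards_draws h1 // -(bin_sub (leq_pred _)) -subn1
    subKn // bin1.
rewrite (exchange_big_dep (fun H : {set E} => #|H| == r.-1)) /=;
  last by move=> l H _ /andP[].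
rewrite -!sum1dep_card big_mkcondr -big_split /=; apply: eq_bigr => H cH.
rewrite cH; under eq_bigl do rewrite andbT.
case: forall_inP => [nc|/forall_inP/forall_inPn[l lS /negPn Hl]].
  by rewrite big1 ?addn0 // => l /andP[/nc/negPf ->].
rewrite (bigD1 l) /= ?lS // big1 // => l' /andP[/andP[l'S Hl']] /(h2 _ _ l'S
  lS).
have /subset_leq_card : H \subset l' :&: l by rewrite subsetI Hl'.
rewrite (eqP cH); lia.
Qed.

Lemma nu_sparse (S1 S2 : {set {set E}}) (H1 : sparse_family 3 S1)
    (H2 : sparse_family 3 S2) : 3 < #|E| -> #|S1| = #|S2| ->
  nu (sparse_paving H1) =1 nu (sparse_paving H2).
Proof.
move=> E3 cS a.
pose g k := k * (a == [:: 0; 1; k.-1; #|E| - k]).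
have key (S : {set {set E}}) (HS : sparse_family 3 S) :
  nu (sparse_paving HS) a = #|S| * g 3 + ('C(#|E|, 2) - 3 * #|S|) * g 2.
  rewrite nu_simple3 ?sparse_mrank //; last by apply: (sparse_simple HS).
  have -> : \sum_(H : flat (sparse_paving HS) | rk (sparse_paving HS) H == 2) g
    #|H|
     = \sum_(H : {set E} | is_flat (sparse_paving HS) H && (rk (sparse_paving
       HS) H == 2)) g #|H|.
    rewrite [RHS](reindex_omap (val : flat (sparse_paving HS) -> {set E})
      insub) /=; last first.
      by move=> H /andP[fH _]; rewrite insubT.
    by apply: eq_bigl => H; rewrite flatP /= valK eqxx andbT.
  rewrite (eq_bigl _ _ (fun H => sparse_hyperplane HS H _)) ?E3 //.
  rewrite (bigID (mem S)) /=; congr (_ + _).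
    rewrite (eq_bigl (mem S)) => [|H]; last by rewrite inE; case: (H \in S);
      rewrite ?andbF.
    rewrite -sum_nat_const; apply: eq_bigr => H HS'.
    by case: (HS) => ->.
  rewrite -(card_uncovered HS) // addnK -sum_nat_const.
  apply: eq_big => [H|H /andP[+ HnS]].
    rewrite inE; have [HinS|HnS] := boolP (H \in S); rewrite /= ?andbT //.
    by case: (HS) => /(_ _ HinS) -> _.
  by rewrite (negPf HnS) => /andP[/eqP ->].
by rewrite (key _ H1) (key _ H2) cS.
Qed.
End NuSparse.

Local Open Scope ring_scope.

(** * Base polytopes *)

Section Cone.
Variables (R : realType) (E : finType).
Implicit Types (P : pred {set E}) (A B l : {set E}) (t : R) (p q : {ffun E ->
  R^o}).

Definition indicator B : {ffun E -> R^o} := [ffun b => (b \in B)%:R].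

(** Nonnegative combinations of total mass [t], rather than convex ones, so that
    rewriting a point piece by piece is compatible with sums. *)
Definition cone P t p : Prop := exists w : {set E} -> R,
  [/\ forall B, 0 <= w B, forall B, ~~ P B -> w B = 0,
      \sum_B w B = t & p = \sum_B w B *: indicator B].

Lemma base_polytopeP (M : matroid E) p :
  base_polytope R M p <-> cone (is_basis M) 1 p.
Proof.
split=> [[w [w0 w1 ->]]|[w [w0 wP w1 ->]]].
  exists (fun B => if is_basis M B then w B else 0);
    split=> [B|B /negPf -> //||].
  - by case: ifP => // /w0.
  - by rewrite -big_mkcond.
  - by rewrite big_mkcond; apply: eq_bigr => B _; case: ifP; rewrite ?scale0r.
exists w; split=> [B _ //||].
- by rewrite big_mkcond -w1; apply: eq_bigr => B _;
  case: ifP => // /negbT/wP ->.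
- rewrite [RHS]big_mkcond; apply: eq_bigr => B _.
  by case: ifP => // /negbT/wP ->; rewrite scale0r.
Qed.

Lemma cone_sub P (Q : pred {set E}) t p : (forall B, P B -> Q B) -> cone P t p
  -> cone Q t p.
Proof.
move=> PQ [w [w0 wP wt ->]]; exists w; split=> // B QB.
by apply: wP; apply: contra QB => /PQ.
Qed.

Lemma cone0 P : cone P 0 0.
Proof.
exists (fun=> 0); split=> //; first by rewrite big1.
by rewrite big1 // => B _; rewrite scale0r.
Qed.

Lemma coneD P t u p q : cone P t p -> cone P u q -> cone P (t + u) (p + q).
Proof.
move=> [w [w0 wP <- ->]] [z [z0 zP <- ->]].
exists (fun B => w B + z B); split=> [B|B PB||].
- exact: addr_ge0.
- by rewrite wP ?zP ?addr0.
- by rewrite big_split.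
- by rewrite -big_split; apply: eq_bigr => B _; rewrite scalerDl.
Qed.

Lemma coneZ P c t p : 0 <= c -> cone P t p -> cone P (c * t) (c *: p).
Proof.
move=> c0 [w [w0 wP <- ->]].
exists (fun B => c * w B); split=> [B|B PB||].
- exact: mulr_ge0.
- by rewrite wP ?mulr0.
- by rewrite mulr_sumr.
- by rewrite scaler_sumr; apply: eq_bigr => B _; rewrite scalerA.
Qed.

Lemma cone_indicator P B : P B -> cone P 1 (indicator B).
Proof.
move=> PB; exists (fun C => (C == B)%:R); split=> [C|C PC||].
- by rewrite ler0n.
- by have [CB|//] := eqVneq C B; rewrite CB PB in PC.
- rewrite (bigD1 B) //= eqxx big1 ?addr0 // => C /negPf -> //.
- rewrite (bigD1 B) //= eqxx big1 ?addr0 ?scale1r // => C /negPf ->.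
  by rewrite scale0r.
Qed.

Lemma cone_sum P (I : finType) (Q : pred I) (t : I -> R) (p : I -> {ffun E ->
  R^o}) :
  (forall i, Q i -> cone P (t i) (p i)) ->
  cone P (\sum_(i | Q i) t i) (\sum_(i | Q i) p i).
Proof.
move=> H; elim/big_rec2: _ => [|i q u Qi]; first exact: cone0.
by apply: coneD; apply: H.
Qed.

Lemma sum_eq_in (A : {set E}) (e : E) : \sum_(a in A) (e == a)%:R = (e \in
  A)%:R :> R.
Proof.
have [eA|eA] := boolP (e \in A).
  rewrite (bigD1 e) //= eqxx big1 ?addr0 // => a /andP[_ /negPf].
  by rewrite eq_sym => ->.
rewrite big1 // => a aA; case: eqP => // ea.
by rewrite -ea (negPf eA) in aA.
Qed.

(** The exchange identity behind relaxation. Averaging the indicators of l -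
    y + a over all a in [B :\: l] and y in [l :\: B], with k = #|B :\: l|
    choices for each, gives e_B + (k - 1) e_l after rescaling to mass k. All
    the sets used meet l in r - 1 points. *)
Lemma cone_exchange (r : nat) B l : #|B| = r -> #|l| = r -> B != l ->
  cone (fun C => (#|C| == r) && (#|C :&: l|.+1 == r)) #|B :\: l|%:R
    (indicator B + (#|B :\: l|%:R - 1) *: indicator l).
Proof.
move=> cB cl Bl; set k := #|B :\: l|.
have kl : #|l :\: B| = k.
  by rewrite /k; have := cardsID l B; have := cardsID B l; rewrite setIC; lia.
have k0 : k%:R != 0 :> R.
  rewrite pnatr_eq0 cards_eq0 setD_eq0; apply: contra Bl => sBl.
  by rewrite eqEcard sBl cl cB /=.
have -> : indicator B + (k%:R - 1) *: indicator l =
    \sum_(a in B :\: l) \sum_(y in l :\: B) k%:R^-1 *: indicator (a |: l :\ y).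
  apply/ffunP => e; rewrite sum_ffunE.
  transitivity (\sum_(a in B :\: l) \sum_(y in l :\: B)
    (k%:R^-1 * ((e == a)%:R + (e \in l)%:R - (e == y)%:R)) : R); last first.
    apply: eq_bigr => a; rewrite inE => /andP[al aB].
    rewrite sum_ffunE; apply: eq_bigr => y; rewrite inE => /andP[yB yl].
    rewrite !ffunE !inE /=; congr (_ * _).
    have [->|ea] := eqVneq e a.
      by have [ay|_] := eqVneq a y; [rewrite ay yl in al | rewrite (negPf al)
        /= addr0 subr0].
    have [->|ey] := eqVneq e y; first by rewrite yl add0r subrr.
    by rewrite add0r subr0.
  rewrite !ffunE /GRing.scale /=.
  transitivity (\sum_(a in B :\: l) (k%:R^-1 *
     (k%:R * (e == a)%:R + k%:R * (e \in l)%:R - (e \in l :\: B)%:R)) : R);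
       last first.
    apply: eq_bigr => a _; rewrite -mulr_sumr sumrB sumr_const kl sum_eq_in.
    by congr (_ * (_ - _)); rewrite -[RHS]mulr_natl mulrDr.
  rewrite -mulr_sumr sumrB big_split /= -mulr_sumr !sumr_const -/k sum_eq_in.
  rewrite -[(_ * _) *+ k]mulr_natr -[_%:R *+ k]mulr_natr !inE.
  by case: (e \in B) (e \in l) => [] []; rewrite /=; field.
have kE : k%:R = \sum_(a in B :\: l) \sum_(y in l :\: B) (k%:R^-1 * 1) :> R.
  by rewrite mulr1 !sumr_const kl -/k -[_^-1 *+ k]mulr_natr mulVf.
rewrite [X in cone _ X _]kE; apply: cone_sum => a; rewrite inE => /andP[al aB].
apply: cone_sum => y; rewrite inE => /andP[yB yl].
apply: coneZ; first by rewrite invr_ge0 ler0n.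
apply: cone_indicator; have := cardsD1 y l; rewrite yl cl => cly.
have -> : (a |: l :\ y) :&: l = l :\ y.
  apply/setP => x; rewrite !inE; have [->|_] := eqVneq x a => /=.
    by rewrite (negPf al) !andbF.
  by rewrite -andbA andbb.
rewrite cardsU1 !inE (negPf al) andbF /=; lia.
Qed.

Lemma sum_indicator l (w : {set E} -> R) :
  \sum_(e in l) (\sum_B w B *: indicator B : {ffun E -> R^o}) e =
  \sum_B w B * #|B :&: l|%:R.
Proof.
under eq_bigr do rewrite sum_ffunE.
rewrite exchange_big /=; apply: eq_bigr => B _.
under eq_bigr do rewrite !ffunE.
rewrite -mulr_sumr; congr (_ * _).
rewrite -sum1_card natr_sum (eq_bigl (fun e => (e \in l) && (e \in B)));
  last first.
  by move=> e; rewrite inE andbC.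
by rewrite big_mkcondr; apply: eq_bigr => e _; case: ifP.
Qed.

Section Relaxation.
Variable r : nat.

Definition non_member (S : {set {set E}}) B := (#|B| == r) && (B \notin S).

(** If p(l) <= r - 1 then the mass that a combination puts on [l] can be
    absorbed by the other bases.  A basis B with k_B = #|B :\: l| can absorb
    k_B - 1 times its own mass of [l], by [cone_exchange]; the hypothesis on
    p(l) says exactly that the total capacity D is at least the mass on [l].
    The sets produced meet [l] in r - 1 points, hence are not in [S]. *)
Lemma cone_add_member l (S : {set {set E}}) p :
  sparse_family r (l |: S) -> cone (non_member S) 1 p ->
  \sum_(e in l) p e <= r%:R - 1 -> cone (non_member (l |: S)) 1 p.
Proof.
move=> HS [w [w0 wP w1 pE]]; rewrite pE sum_indicator => pl.
have cl : #|l| = r by case: HS => -> //; rewrite setU11.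
pose k B : R := #|B :\: l|%:R.
have capE B : w B * #|B :&: l|%:R = w B * r%:R - w B * k B.
  have [/andP[/eqP cB _]|/wP ->] := boolP (non_member S B);
    last by rewrite !mul0r subr0.
  rewrite -mulrBr /k -cB -(cardsID l B) natrD; congr (_ * _).
  by rewrite addrK.
have kl : k l = 0 by rewrite /k setDv cards0.
pose D := \sum_(B | B != l) w B * (k B - 1).
have wD : w l <= D.
  move: pl; rewrite (eq_bigr _ (fun B _ => capE B)) sumrB -mulr_suml w1 mul1r.
  rewrite (bigD1 l) //= kl mulr0 add0r => pl.
  have : 1 = w l + \sum_(B | B != l) w B by rewrite -w1 (bigD1 l).
  rewrite /D; under [X in _ <= X]eq_bigr do rewrite mulrBr mulr1.
  rewrite sumrB; move: pl; set x := \sum_(_ | _) _ * _; set y := \sum_(_ | _) _.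
  by clearbody x y => ? ?; lra.
(* The fraction of each w B to be used; if D = 0 then w l = 0 and th = 0. *)
pose th := w l / D.
have D0 : 0 <= D := le_trans (w0 l) wD.
have th0 : 0 <= th by rewrite divr_ge0.
have th1 : 0 <= 1 - th.
  rewrite subr_ge0 /th; have [->|Dn] := eqVneq D 0;
    first by rewrite invr0 mulr0.
  by rewrite ler_pdivrMr ?mul1r // lt_def Dn.
have thD : th * D = w l.
  rewrite /th; have [D00|Dn] := eqVneq D 0; last by rewrite divfK.
  by rewrite D00 mulr0; apply/eqP; rewrite eq_le w0 -D00 wD.
have -> : \sum_B w B *: indicator B = \sum_(B | B != l)
   (((1 - th) * w B) *: indicator B + (th * w B) *: (indicator B + (k B - 1) *:
     indicator l)).
  rewrite (bigD1 l) //= -thD /D mulr_sumr scaler_suml -big_split /=.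
  apply: eq_bigr => B _; apply/ffunP => e; rewrite !ffunE /= /GRing.scale /=.
  by ring.
have mass : 1 = \sum_(B | B != l) ((1 - th) * w B * 1 + (th * w B) * k B) :> R.
  rewrite -{1}w1 (bigD1 l) //= -thD /D mulr_sumr -big_split /=.
  by apply: eq_bigr => B _; ring.
rewrite [X in cone _ X _]mass; apply: cone_sum => B Bl;
  have [PB|/wP ->] := boolP (non_member S B); last first.
  by rewrite !mulr0 !mul0r !scale0r !addr0; apply: cone0.
have /andP[/eqP cB BS] := PB.
apply: coneD; apply: coneZ; rewrite ?(mulr_ge0 th0) ?(mulr_ge0 th1) //.
  by apply: cone_indicator; rewrite /non_member cB eqxx !inE negb_or Bl BS.
apply: (cone_sub _ (cone_exchange cB cl Bl)) => C /andP[cC /eqP Cl].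
rewrite /non_member cC /=; apply/negP => CS.
have Cnl : C != l.
  by apply/eqP => Cl'; move: Cl; rewrite Cl' setIid cl; lia.
case: HS => _ /(_ C l CS (setU11 _ _) Cnl); lia.
Qed.

Definition uniform_cone := cone (non_member set0) 1.

Lemma cone_non_member (S : {set {set E}}) p : sparse_family r S ->
  cone (non_member S) 1 p <->
  uniform_cone p /\ {in S, forall l : {set E}, \sum_(e in l) p e <= r%:R - 1}.
Proof.
move=> HS; split.
  move=> pS; split; first by apply: cone_sub pS => B /andP[cB _];
    rewrite /non_member cB inE.
  move=> l lS; case: pS => w [w0 wP w1 ->]; rewrite sum_indicator.
  rewrite -[X in _ <= X]mul1r -[X in _ <= X * _]w1 mulr_suml;
    apply: ler_sum => B _.
  have [/andP[/eqP cB BS]|/wP ->] := boolP (non_member S B);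
    last by rewrite !mul0r.
  apply: ler_wpM2l => //; case: HS => /(_ l lS) cl _.
  rewrite lerBrDr natr1 ler_nat -cB; apply: proper_card.
  rewrite properE subsetIl subsetI subxx /=; apply/negP => Bl.
  by move: BS; suff -> : B = l by [rewrite lS]; apply/eqP;
    rewrite eqEcard Bl cB cl /=.
case=> pU; have [n] := ubnP #|S|; elim: n S HS => // n IH S HS cS pS.
have [->//|[l lS]] := set_0Vmem S.
have SE := setD1K lS; rewrite -SE; apply: cone_add_member; rewrite ?SE //;
  last exact: pS.
apply: IH.
- by case: HS => h1 h2; split=> [x /setD1P[_ /h1]|x y /setD1P[_ xS] /setD1P[_
  yS]] //; apply: h2.
- by move: cS; rewrite (cardsD1 l) lS.
- by move=> x /setD1P[_ /pS].
Qed.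

(** p(l) + p(l') = p(l :|: l') + p(l :&: l') is at most r + (r - 2). *)
Lemma uniform_two_members l l' p : uniform_cone p -> #|l| = r -> #|l'| = r ->
  (#|l :&: l'| + 2 <= r)%N ->
  \sum_(e in l) p e <= r%:R - 1 \/ \sum_(e in l') p e <= r%:R - 1.
Proof.
case=> w [w0 wP w1 ->] cl cl' ll'; rewrite !sum_indicator.
suff : \sum_B w B * #|B :&: l|%:R + \sum_B w B * #|B :&: l'|%:R <=
       (r%:R + r%:R) - 2%:R.
  set x := \sum_B _; set y := \sum_B _ => xy.
  have [|] := lerP x (r%:R - 1); first by left.
  by right; lra.
rewrite -big_split -[X in _ <= X]mul1r -[X in _ <= X * _]w1 mulr_suml;
  apply: ler_sum => B _ /=.
have [/andP[/eqP cB _]|/wP ->] := boolP (non_member set0 B);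
  last by rewrite !mul0r addr0.
rewrite -mulrDr; apply: ler_wpM2l => //.
rewrite lerBrDr -!natrD ler_nat.
have := cardsUI (B :&: l) (B :&: l'); rewrite -setIUr -setIIr.
have := subset_leq_card (subsetIl B (l :|: l')).
have := subset_leq_card (subsetIr B (l :&: l')).
by rewrite cB; lia.
Qed.

Lemma base_polytope_sparse (S : {set {set E}}) (HS : sparse_family r S) p :
  (0 < r < #|E|)%N ->
  base_polytope R (sparse_paving HS) p <->
  uniform_cone p /\ {in S, forall l : {set E}, \sum_(e in l) p e <= r%:R - 1}.
Proof.
move=> /andP[r0 rE]; rewrite -cone_non_member // base_polytopeP.
by split; apply: cone_sub => B; rewrite sparse_basisE.
Qed.

End Relaxation.
End Cone.

Section Swap.
Variables (R : realType) (E : finType) (r : nat).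
Hypothesis rE : (0 < r < #|E|)%N.
Variables (S : {set {set E}}).

Lemma sparse_family1 l : sparse_family r (l |: S) -> sparse_family r [set l].
Proof.
case=> h1 _; split=> [x /set1P -> | x y /set1P -> /set1P ->];
  last by rewrite eqxx.
by apply: h1; rewrite setU11.
Qed.

Lemma in_base_polytope (T : {set {set E}}) (HT : sparse_family r T) p :
  (p \in base_polytope R (sparse_paving HT)) =
  `[< uniform_cone r p >] &&
  [forall l in T, \sum_(e in l) p e <= r%:R - 1].
Proof.
apply/idP/andP; rewrite in_setE base_polytope_sparse //.
  by case=> u pT; split; [apply/asboolP | apply/forall_inP].
by case=> /asboolP u /forall_inP pT; split.
Qed.

(** A point of the hypersimplex outside the polytope of [S] violates the
    inequality of a member of [S], so it satisfies those of [l] and [l']; on the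
    polytope of [S] both sides are sums of the same two terms. *)
Lemma relaxation_indicator l l' (H1 : sparse_family r (l |: S)) (H2 :
  sparse_family r (l' |: S)) 
   p : l \notin S -> l' \notin S ->
   \1_(base_polytope R (sparse_paving H1)) p +
   \1_(base_polytope R (sparse_paving (sparse_family1 H2))) p =
   \1_(base_polytope R (sparse_paving H2)) p +
   \1_(base_polytope R (sparse_paving (sparse_family1 H1))) p :> int.
Proof.
move=> lS l'S; rewrite !indicE !in_base_polytope.
case: asboolP => //= u.
have inU (x : {set E}) (T : {set {set E}}) :
    [forall m in x |: T, \sum_(e in m) p e <= r%:R - 1] =
    (\sum_(e in x) p e <= r%:R - 1) && [forall m in T, \sum_(e in m) p e <=
      r%:R - 1].
  apply/forall_inP/andP => [h|[h1 /forall_inP h2] m].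
    split; first by rewrite h ?setU11.
    by apply/forall_inP => m mT; rewrite h // setU1r.
  by case/setU1P => [->|/h2].
have in1 (x : {set E}) :
    [forall m in [set x], \sum_(e in m) p e <= r%:R - 1] = (\sum_(e in x) p e
      <= r%:R - 1).
  by apply/forall_inP/idP => [-> //|h m /set1P ->]; rewrite ?set11.
rewrite !inU !in1.
have [|] := boolP [forall m in S, \sum_(e in m) p e <= r%:R - 1];
  last case/forall_inPn => [m mS pm].
  by move=> _; rewrite !andbT addrC.
suff ok x : x \notin S -> sparse_family r (x |: S) -> \sum_(e in x) p e <= r%:R
  - 1.
  by rewrite !ok.
move=> xS [h1 h2]; have mU : m \in x |: S by rewrite setU1r.
have [|//|pm'] := uniform_two_members u (h1 _ (setU11 _ _)) (h1 _ mU).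
  by apply: h2 => //; [exact: setU11|apply: contraNneq xS => ->].
by rewrite pm' in pm.
Qed.

Lemma valuative_swap (G : zmodType) (f : forall E : finType, matroid E -> G)
   l l' (H1 : sparse_family r (l |: S)) (H2 : sparse_family r (l' |: S)) :
   matroid_invariant f -> valuative R f -> l \notin S -> l' \notin S ->
   f E (sparse_paving H1) = f E (sparse_paving H2).
Proof.
move=> fI fV lS l'S; have /andP[r0 rlt] := rE.
pose M1 := sparse_paving (sparse_family1 H1).
pose M2 := sparse_paving (sparse_family1 H2).
have f12 : f E M1 = f E M2.
  apply: fI; have [phi phil] : exists phi : {perm E}, phi @: l = l'.
    apply: perm_between; have [h1 _] := H1; have [h2 _] := H2.
    by rewrite h1 ?h2 ?setU11.
  apply: (@sparse_iso _ _ _ _ _ _ phi) => A.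
  by rewrite !inE -phil (inj_eq (imset_inj (@perm_inj _ phi))).
pose M (i : 'I_4) := nth M1 [:: sparse_paving H1; sparse_paving H2; M1; M2] i.
pose c (i : 'I_4) : int := nth 0 [:: 1; -1; -1; 1] i.
have := fV E 4 M c; rewrite !big_ord_recr !big_ord0 /= /M /c /= f12.
rewrite !mulrN1z !mulr1z add0r addrNK => H; apply/eqP; rewrite -subr_eq0;
  apply/eqP/H.
  have Mr i : mrank (M i) = r.
    by case: i => -[|[|[|[|k]]]] // ?; apply: sparse_mrank.
  by move=> i j; rewrite !Mr.
move=> p; rewrite !big_ord_recr !big_ord0 /=.
have := relaxation_indicator H1 H2 p lS l'S; rewrite -/M1 -/M2 => e.
move: e; set i1 : int := \1_(base_polytope R (sparse_paving H1)) p.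
set i2 : int := \1_(base_polytope R (sparse_paving H2)) p.
set j1 : int := \1_(base_polytope R M1) p; set j2 : int := \1_(base_polytope R
  M2) p.
by clearbody i1 i2 j1 j2; lia.
Qed.

End Swap.

(** * The first level of the filtration *)

Section FirstLevel.
Variables (R : realType) (E : finType) (M : matroid E).
Hypothesis r0 : (0 < mrank M)%N.
Local Notation r := (mrank M).
Local Notation RL := {ffun flat M -> R^o}.
Implicit Types (x y a : flat M) (u v : RL).

Definition avoiding a : RL :=
  [ffun x : flat M => if (rk M x == r.-1) && ~~ (a <= x)%O then (beta x)%:R
    else 0].

Lemma v_E k x : v_ R M k x = if rk M x == k then (beta x)%:R else 0.
Proof.
rewrite sum_ffunE; case: ifP => xk.
  rewrite (bigD1 x) //= big1 ?addr0 => [|y /andP[_ yx]].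
    by rewrite RL_scaleE ffunE eqxx mulr1.
  by rewrite RL_scaleE ffunE eq_sym (negPf yx) mulr0.
rewrite big1 // => y yk; rewrite RL_scaleE ffunE.
by have [xy|_] := eqVneq x y; [rewrite xy yk in xk | rewrite mulr0].
Qed.

Lemma lin_ext_diag (h : flat M -> RL) (g : flat M -> R) u x :
  (forall y, h y = g y *: e_ R y) -> lin_ext h u x = g x * u x.
Proof.
move=> hE; rewrite lin_extE sum_ffunE (bigD1 x) //= big1 ?addr0 => [|y yx].
  by rewrite hE !RL_scaleE ffunE eqxx mulr1 mulrC.
by rewrite hE !RL_scaleE ffunE eq_sym (negPf yx) !mulr0.
Qed.

Lemma adj_beta_coord (T : 'End(RL)) v x :
  adj_beta T v x = (beta x)%:R * dot_beta (T (e_ R x)) v.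
Proof.
by rewrite adj_betaP dot_betaC dot_beta_e mulrC divfK // beta_unit.
Qed.

Lemma Lbeta_top a : atom a -> Lbeta R a (v_ R M r) = avoiding a.
Proof.
move=> a1; apply/ffunP => x; rewrite adj_beta_coord ffunE lin_ext_e.
rewrite -join_atom_top //; case: (boolP (a <= x)%O) => ax /=.
  by rewrite /dot_beta big1 ?mulr0 // => y _; rewrite ffunE !mul0r.
rewrite dot_betaC dot_beta_e v_E flat_top_rk.
by case: ifP => // _; rewrite ?mul0r ?mulr0 // divff ?mulr1 // beta_unit.
Qed.

(** Each hyperplane [H] receives beta_H once for every atom outside it, and
    [Sinv] divides by the number [s_ H] of these atoms. *)
Lemma Dbeta_top : Dbeta R M (v_ R M r) = r%:R *: v_ R M r.-1.
Proof.
rewrite !comp_lfunE.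
have -> : K_op R M (v_ R M r) = r%:R *: v_ R M r.
  apply/ffunP => x; rewrite (lin_ext_diag (g := fun y => (rk M y)%:R)) //.
  by rewrite RL_scaleE v_E; case: eqP => [->|]; rewrite ?mulr0.
rewrite !linearZ /=; congr (_ *: _).
rewrite sum_lfunE (eq_bigr avoiding) => [|a a1]; last exact: Lbeta_top.
apply/ffunP => x; rewrite v_E.
rewrite (lin_ext_diag (g := fun y => if y == \top%O then 0 else (s_ y)%:R^-1));
  last first.
  by move=> y; case: ifP; rewrite ?scale0r.
have [xr|xr] := eqVneq (rk M x) r.-1; last first.
  rewrite sum_ffunE big1 ?mulr0 // => a _.
  by rewrite ffunE (negPf xr).
have xT : x != \top%O by rewrite -flat_top_rk xr -{2}(prednK r0) ltn_eqF.
rewrite (negPf xT) sum_ffunE.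
rewrite (eq_bigr (fun a => if ~~ (a <= x)%O then (beta x)%:R else 0));
  last first.
  by move=> a _; rewrite ffunE xr eqxx.
rewrite -big_mkcondr sumr_const -[X in _ * X]mulr_natl mulrA s_E.
rewrite (eq_card (B := [set a | atom a & ~~ (a <= x)%O])); last by move=> a;
  rewrite inE.
rewrite mulVf ?mul1r // pnatr_eq0 cards_eq0; apply/set0Pn.
by have [a] := exists_atom_not_le xT; exists a; rewrite inE.
Qed.

Local Notation atoms := (enum (@atom E M)).

Lemma Cbeta1 : Cbeta R M 1 = <<v_ R M r.-1 :: [seq avoiding a | a <-
  atoms]>>%VS.
Proof.
rewrite /= span_cons limg_line Dbeta_top; congr (_ + _)%VS.
  apply/eqP; rewrite eqEsubv -!memvE.
  have rn0 : r%:R != 0 :> R by rewrite pnatr_eq0 -lt0n.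
  rewrite memvZ ?memv_line //=; have := memvZ r%:R^-1 (memv_line (r%:R *: v_ R
    M r.-1)).
  by rewrite scalerK.
rewrite span_def big_map big_enum /=; apply: eq_bigr => a a1.
by rewrite limg_line Lbeta_top.
Qed.

Lemma lin_comb_avoiding (c0 : R) (c : flat M -> R) x :
  (c0 *: v_ R M r.-1 + \sum_(a | atom a) c a *: avoiding a) x =
  if rk M x == r.-1 then (beta x)%:R * (c0 + \sum_(a | atom a && ~~ (a <= x)%O)
    c a)
  else 0.
Proof.
rewrite RL_addE RL_scaleE v_E sum_ffunE.
have [xr|xr] := eqVneq (rk M x) r.-1; last first.
  rewrite mulr0 add0r big1 // => a _.
  by rewrite RL_scaleE ffunE (negPf xr) mulr0.
rewrite mulrDr mulrC mulr_sumr big_mkcondr; congr (_ + _).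
apply: eq_bigr => a _; rewrite RL_scaleE ffunE xr eqxx /=.
by case: ifP; rewrite ?mulr0 // mulrC.
Qed.

Lemma hbeta1_le (c : flat M -> R) :
  (forall x, rk M x = r.-1 -> \sum_(a | atom a && ~~ (a <= x)%O) c a = 1) ->
  (hbeta R M 1 <= #|@atom E M|)%N.
Proof.
move=> Hc; rewrite /hbeta Cbeta1 cardE -(size_map avoiding).
set X := map _ _; suff sub : (<<v_ R M r.-1 :: X>> <= <<X>>)%VS.
  exact: leq_trans (dimvS sub) (dim_span X).
apply/span_subvP => u /predU1P[->|/memv_span//].
have -> : v_ R M r.-1 = \sum_(a | atom a) c a *: avoiding a.
  apply/ffunP => x; have := lin_comb_avoiding 0 c x.
  rewrite scale0r !add0r v_E => ->; case: eqP => // /Hc ->.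
  by rewrite mulr1.
apply: memv_suml => a a1; apply/memvZ/memv_span/mapP; exists a => //.
by rewrite mem_enum.
Qed.

Lemma hbeta1_eq :
  (forall (c0 : R) (c : flat M -> R),
     (forall x, rk M x = r.-1 -> c0 + \sum_(a | atom a && ~~ (a <= x)%O) c a =
       0) ->
     c0 = 0 /\ forall a, atom a -> c a = 0) ->
  hbeta R M 1 = #|@atom E M|.+1.
Proof.
move=> H; rewrite /hbeta Cbeta1.
pose X := [tuple of v_ R M r.-1 :: [tuple of map avoiding (enum_tuple (@atom E
  M))]].
suff : free X by move/eqP => ->; rewrite size_tuple.
apply/freeP => k; rewrite big_ord_recl => k0.
pose c a := k (inord (index a atoms).+1).
have lift_rank i : k (lift ord0 i) = c (enum_val i).
  congr k; apply/val_inj; rewrite /= inordK /bump /=.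
    by rewrite /enum_val index_uniq ?enum_uniq // -cardE.
  by rewrite ltnS cardE index_mem mem_enum enum_valP.
have {k0} comb0 : k ord0 *: v_ R M r.-1 + \sum_(a | atom a) c a *: avoiding a =
  0.
  rewrite -[RHS]k0; congr (_ + _).
  rewrite (big_enum_val (A := @atom E M)) /=; apply: eq_bigr => i _.
  by rewrite lift_rank (nth_map (enum_default i)) // -cardE; exact: (ltn_ord i).
have [x xr|k00 kc i] := H (k ord0) c.
  have := lin_comb_avoiding (k ord0) c x.
  rewrite comb0 ffunE xr eqxx => /esym/eqP; rewrite mulf_eq0 (negPf (beta_unit
    _ _)).
  by move/eqP.
case: (unliftP ord0 i) => [j|] -> //.
by rewrite lift_rank kc //; exact: (enum_valP j).
Qed.

End FirstLevel.

Section PointCriteria.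
Variables (R : realType) (E : finType) (M : matroid E).
Hypotheses (sM : simple_matroid M) (r0 : (0 < mrank M)%N).

Definition hyperplane (H : {set E}) := is_flat M H && (rk M H == (mrank M).-1).

Lemma hbeta1_le_card (c : E -> R) :
  (forall H, hyperplane H -> \sum_(e in ~: H) c e = 1) ->
  (hbeta R M 1 <= #|E|)%N.
Proof.
move=> Hc; rewrite -(card_atom sM).
(* On the atom {e} the extension of c to flats is c e. *)
apply: (hbeta1_le (R := R) r0 (c := fun a => \sum_(e in (a : {set E})) c e)) =>
  x xr.
rewrite sum_atom // -(Hc x); last by rewrite /hyperplane flatP xr eqxx.
apply: eq_big => [e|e _]; first by rewrite point_le // inE.
by rewrite pointE // big_set1.
Qed.

Lemma hbeta1_eq_card :
  (forall (c0 : R) (c : E -> R),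
     (forall H, hyperplane H -> c0 + \sum_(e in ~: H) c e = 0) ->
     c0 = 0 /\ forall e, c e = 0) ->
  hbeta R M 1 = #|E|.+1.
Proof.
move=> Hc; rewrite -(card_atom sM); apply: hbeta1_eq => // c0 c H0.
have [H /andP[fH rH]|-> c'0] := Hc c0 (c \o point M).
  rewrite -[RHS](H0 (Flat fH) (eqP rH)) sum_atom //; congr (_ + _).
  by apply: eq_bigl => e; rewrite point_le // inE.
by split=> // a /(atom_point sM)[e ->]; exact: c'0.
Qed.

End PointCriteria.

(** * Rank 3: systems of three-point lines *)

Section TripleSystems.
Variables (R : realType) (E : finType) (S : {set {set E}}).
Hypotheses (HS : sparse_family 3 S) (E3 : (3 < #|E|)%N).
Local Notation M := (sparse_paving HS).

Let sM : simple_matroid M. Proof. exact: sparse_simple. Qed.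
Let r0 : (0 < mrank M)%N. Proof. by rewrite sparse_mrank. Qed.

Let hyperplaneE H : hyperplane M H =
  (H \in S) || (#|H| == 2%N) && [forall l in S, ~~ (H \subset l)].
Proof. by rewrite /hyperplane sparse_mrank // sparse_hyperplane. Qed.

(** Every hyperplane contains exactly two points other than [z]: a line of
    [S] is [z] and two more points, and a two-point line cannot contain [z],
    which is already joined to each point by a line of [S]. So weight 0 at
    [z] and 1 / (#|E| - 3) elsewhere has sum 1 off every hyperplane. *)
Lemma hbeta1_pencil z :
  {in S, forall l : {set E}, z \in l} ->
  (forall x, x != z -> exists2 l, l \in S & x \in l) ->
  (hbeta R M 1 <= #|E|)%N.
Proof.
move=> zS Sz.
apply: (hbeta1_le_card (R := R) sM r0
  (c := fun e => if e == z then 0 else (#|E| - 3)%N%:R^-1)) => H hH.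
suff cH : #|~: H :\ z| = (#|E| - 3)%N.
  rewrite (eq_bigr (fun e => if e != z then (#|E| - 3)%N%:R^-1 else 0));
    last first.
    by move=> e _; case: eqP.
  rewrite -big_mkcondr (eq_bigl (mem (~: H :\ z))) => [|e];
    last by rewrite !inE andbC.
  rewrite sumr_const cH -[LHS]mulr_natr mulVf // pnatr_eq0; lia.
have := cardsC H; have := cardsD1 z (~: H); rewrite inE.
move: hH; rewrite hyperplaneE => /orP[HinS|/andP[/eqP cH /forall_inP nc]].
  by case: (HS) => /(_ _ HinS) -> _; rewrite zS //=; lia.
suff -> : z \in H = false by rewrite cH; lia.
apply/negP => zH; have := cardsD1 z H; rewrite zH cH => c1.
have /cards1P[x Hx] : #|H :\ z| == 1%N by lia.
have : x \in H :\ z by rewrite Hx set11.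
rewrite !inE => /andP[xz xH]; have [l lS xl] := Sz x xz.
have /negP := nc l lS; apply; rewrite -(setD1K zH) Hx subUset !sub1set xl.
by rewrite zS.
Qed.

(** In a linear relation all hyperplanes have the same total weight [T]. The
    two-point lines through [z] force weight T - c_z =: g on every other
    point; then 2 g = T by the line {x, y} and 3 g = T by the line [l], so g
    = T = 0. *)
Lemma hbeta1_free_point z l x y :
  {in S, forall l : {set E}, z \notin l} -> l \in S ->
  x != y -> x != z -> y != z ->
  {in S, forall l : {set E}, ~~ ([set x; y] \subset l)} ->
  hbeta R M 1 = #|E|.+1.
Proof.
move=> zS lS xy xz yz xyS; apply: hbeta1_eq_card => // c0 c Hc.
pose T := c0 + \sum_e c e.
have sumH H : hyperplane M H -> \sum_(e in H) c e = T.
  move=> /Hc e0; rewrite /T [X in c0 + X](bigID (mem H)) /= addrCA.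
  have <- : \sum_(e in ~: H) c e = \sum_(e | e \notin H) c e.
    by apply: eq_bigl => e; rewrite inE.
  by rewrite e0 addr0.
have pairT u v : u != v -> {in S, forall l : {set E}, ~~ ([set u;
  v] \subset l)} ->
    c u + c v = T.
  move=> uv uvS; rewrite -(sumH [set u; v]); first by rewrite big_setU1 ?inE
    //= big_set1.
  by rewrite hyperplaneE cards2 uv /=; apply/orP; right; apply/forall_inP.
have cE e : e != z -> c e = T - c z.
  move=> ez; rewrite -(pairT e z) ?addrK // => l' l'S.
  by apply: contra (zS _ l'S) => /subsetP; apply; rewrite !inE eqxx orbT.
have := pairT x y xy xyS; rewrite (cE x xz) (cE y yz) => T2.
have := sumH l; rewrite hyperplaneE lS => /(_ isT).
rewrite (eq_bigr (fun=> T - c z)) => [|e el]; last first.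
  by rewrite cE //; apply: contraTneq el => ->; exact: zS.
rewrite sumr_const; case: (HS) => /(_ _ lS) -> _ T3.
have T0 : T = 0 by move: T2 T3; rewrite !mulrS; lra.
have z0 : c z = 0 by move: T2; rewrite T0; lra.
have c_0 e : c e = 0 by have [->//|/cE->] := eqVneq e z; rewrite T0 z0 subr0.
by split=> //; move: T0; rewrite /T big1 ?addr0.
Qed.

End TripleSystems.

Lemma Hbeta_neq (R : realType) (E1 E2 : finType) (M1 : matroid E1) (M2 :
  matroid E2) k :
  (k <= mrank M1)%N -> (k <= mrank M2)%N -> hbeta R M1 k != hbeta R M2 k ->
  Hbeta R M1 <> Hbeta R M2.
Proof.
move=> k1 k2 /eqP h12 /(congr1 (fun p : {poly R} => p`_k)).
rewrite !coef_poly !ltnS k1 k2 => /eqP; rewrite eqr_nat => /eqP; exact: h12.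
Qed.

(** * Two configurations of three lines on seven points *)

Definition line (s : seq nat) : {set 'I_7} := [set x : 'I_7 | val x \in s].

Definition common_lines := [set line [:: 0; 1; 2]; line [:: 0; 3; 4]].
Definition pencil_line := line [:: 0; 5; 6].
Definition triangle_line := line [:: 1; 3; 5].

Lemma line_in i s (Hi : (i < 7)%N) : (Ordinal Hi \in line s) = (i \in s).
Proof. by rewrite inE. Qed.

Lemma line_eqF (s t : seq nat) : has (fun i => (i < 7)%N && (i \notin t)) s ->
  (line s == line t) = false.
Proof.
case/hasP => i is_ /andP[i7 it]; apply/eqP => /setP/(_ (Ordinal i7)).
by rewrite !inE /= is_ (negPf it).
Qed.

Lemma card_line s : #|line s| = count (fun i => i \in s) (iota 0 7).
Proof.
rewrite -sum1dep_card -(big_mkord (fun i => i \in s) (fun=> 1%N)).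
by rewrite -sum1_count.
Qed.

Lemma lineI s t : line s :&: line t = line [seq i <- s | i \in t].
Proof. by apply/setP => x; rewrite !inE mem_filter andbC. Qed.

Lemma sparse_three_lines s1 s2 s3 :
   [&& #|line s1| == 3%N, #|line s2| == 3%N & #|line s3| == 3%N] ->
   [&& (#|line s1 :&: line s2| <= 1)%N, (#|line s1 :&: line s3| <= 1)%N &
       (#|line s2 :&: line s3| <= 1)%N] ->
   sparse_family 3 (line s1 |: [set line s2; line s3]).
Proof.
case/and3P => /eqP c1 /eqP c2 /eqP c3 /and3P[c12 c13 c23]; split.
  by move=> l /setU1P[->|/set2P[]->].
move=> l l' /setU1P[->|/set2P[]->] /setU1P[->|/set2P[]->]; rewrite ?eqxx //;
  rewrite addn2 !ltnS // setIC //.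
Qed.

Lemma pencil_sparse : sparse_family 3 (pencil_line |: common_lines).
Proof. by apply: sparse_three_lines; rewrite ?lineI !card_line. Qed.

Lemma triangle_sparse : sparse_family 3 (triangle_line |: common_lines).
Proof. by apply: sparse_three_lines; rewrite ?lineI !card_line. Qed.

Lemma pencil_line_new : pencil_line \notin common_lines.
Proof. by rewrite !inE !line_eqF. Qed.

Lemma triangle_line_new : triangle_line \notin common_lines.
Proof. by rewrite !inE !line_eqF. Qed.

Lemma card_configurations : #|pencil_line |: common_lines| = #|triangle_line |:
  common_lines|.
Proof. by rewrite !cardsU1 pencil_line_new triangle_line_new. Qed.

Lemma hbeta1_pencil7 (R : realType) : (hbeta R (sparse_paving pencil_sparse) 1
  <= 7)%N.
Proof.
apply: leq_trans (_ : #|'I_7| <= 7)%N; last by rewrite card_ord.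
apply: (hbeta1_pencil R pencil_sparse _ (z := Ordinal (isT : (0 < 7)%N))).
- by rewrite card_ord.
- by move=> l /setU1P[->|/set2P[]->]; rewrite line_in.
- move=> x xz; have [xl|xl] := boolP (x \in pencil_line);
  first by exists pencil_line; rewrite ?setU11.
  have [xl2|xl2] := boolP (x \in line [:: 0; 1; 2]).
    by exists (line [:: 0; 1; 2]); rewrite // !inE eqxx ?orbT.
  exists (line [:: 0; 3; 4]); first by rewrite !inE eqxx ?orbT.
  move: x xz xl xl2 => [[|[|[|[|[|[|[|m]]]]]]] //= Hm]; rewrite !line_in //.
Qed.

Lemma hbeta1_triangle7 (R : realType) : hbeta R (sparse_paving triangle_sparse)
  1 = 8%N.
Proof.
have <- : #|'I_7|.+1 = 8%N by rewrite card_ord.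
apply: (@hbeta1_free_point R _ _ triangle_sparse _ (Ordinal (isT : (6 < 7)%N))
  triangle_line
   (Ordinal (isT : (2 < 7)%N)) (Ordinal (isT : (4 < 7)%N))) => //.
- by rewrite card_ord.
- by move=> l /setU1P[->|/set2P[]->]; rewrite line_in.
- exact: setU11.
- by move=> l /setU1P[->|/set2P[]->]; rewrite subUset !sub1set !line_in.
Qed.

Theorem corollary3p5 (R : realType) :
  (~ exists f : forall E : finType, matroid E -> {poly R},
      [/\ matroid_invariant f,
          valuative R f
        & forall (E : finType) (M : matroid E),
            simple_matroid M -> f E M = Hbeta R M])
  /\
  (exists (E1 E2 : finType) (M1 : matroid E1) (M2 : matroid E2),
      [/\ simple_matroid M1, simple_matroid M2, tutte M1 = tutte M2
        & Hbeta R M1 <> Hbeta R M2])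
  /\
  (exists (E1 E2 : finType) (M1 : matroid E1) (M2 : matroid E2),
      [/\ simple_matroid M1, simple_matroid M2, nu M1 =1 nu M2
        & Hbeta R M1 <> Hbeta R M2])
  /\
  (exists (E1 E2 : finType) (M1 : matroid E1) (M2 : matroid E2),
      [/\ simple_matroid M1, simple_matroid M2, derksenG M1 = derksenG M2
        & Hbeta R M1 <> Hbeta R M2]).
Proof.
have E3 : (3 < #|'I_7|)%N by rewrite card_ord.
pose M1 := sparse_paving pencil_sparse; pose M2 := sparse_paving
  triangle_sparse.
have sM1 : simple_matroid M1 by exact: sparse_simple.
have sM2 : simple_matroid M2 by exact: sparse_simple.
have HM : Hbeta R M1 <> Hbeta R M2.
  apply: (@Hbeta_neq R _ _ M1 M2 1); rewrite ?sparse_mrank //.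
  by rewrite neq_ltn hbeta1_triangle7 ltnS hbeta1_pencil7.
split.
  case=> f [fI fV fH]; apply: HM; rewrite -!fH //.
  by apply: (valuative_swap (R := R)); rewrite ?pencil_line_new
    ?triangle_line_new // E3.
split; [|split]; exists 'I_7, 'I_7, M1, M2; split=> //.
- exact: tutte_sparse card_configurations.
- exact: nu_sparse card_configurations.
- exact: derksenG_sparse card_configurations.
Qed.
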